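(* Let $t,m\in\mathbb{N}$ and let $[m]=P_1\,\dot\cup\,\cdots\,\dot\cup\,P_t$ be a partition of $[m]$ into subsets $P_1,\ldots,P_t$. Let $\mathcal{P}\subseteq[m]$, let $U=\{\sum_{i\in\mathcal{P}}a_i\boldsymbol{e}_i : a_i\ge 0\}\subseteq\mathbb{R}^m$, and let $\varphi:U\to\mathbb{R}$ be convex and positively homogeneous. Suppose that $f:U\to\mathbb{R}$ is one of the following functions: (i) a concave and positively homogeneous function; (ii) for given real numbers $\alpha_{ij}$ ($i\in[t]$, $j\in[|P_i|]$), $f(\boldsymbol{a})=\sum_{i=1}^{t}\sum_{j=1}^{|P_i|}\alpha_{ij}\,\boldsymbol{a}^{i}_{\downarrow j}$, where $\boldsymbol{a}^{i}=\boldsymbol{a}_{|P_i}$. Then the following statements are equivalent: (1) For every $\boldsymbol{a}\in U$, $\varphi(\boldsymbol{a})\le f(\boldsymbol{a})$. (2) For every $\boldsymbol{a}\in U_{\{0,1\}}$, $\varphi(\boldsymbol{a})\le f(\boldsymbol{a})$.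
   Context: $[m]=\{1,\ldots,m\}$; a partition consists of pairwise disjoint nonempty subsets. $\boldsymbol{e}_i$ is the $i$-th standard basis vector of $\mathbb{R}^m$. For $\boldsymbol{x}\in\mathbb{R}^m$ and $P\subseteq[m]$, $\boldsymbol{x}_{|P}$ is the restriction of $\boldsymbol{x}$ to the coordinates indexed by $P$. For a vector $\boldsymbol{x}$ with $p$ coordinates, $\boldsymbol{x}_{\downarrow1}\ge\cdots\ge\boldsymbol{x}_{\downarrow p}$ denotes its coordinates arranged in decreasing order. A function $g$ is positively homogeneous if $g(\alpha\boldsymbol{v})=\alpha g(\boldsymbol{v})$ for all real $\alpha>0$ and all $\boldsymbol{v}$ in its domain. $U_{\{0,1\}}=\{(a_1,\ldots,a_m)\in U: a_i\in\{0,1\}\text{ for all } i\in[m]\}$. *)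

(* Defs.v *)
From HB Require Import structures.
From mathcomp Require Import all_boot all_order all_algebra.
From mathcomp Require Import interval_inference.
From mathcomp Require Import boolp classical_sets reals convex.

Set Implicit Arguments.
Unset Strict Implicit.
Unset Printing Implicit Defensive.

Import Order.TTheory GRing.Theory Num.Theory.

Local Open Scope convex_scope.
Local Open Scope ring_scope.

(* The index set [m] = {1, .., m} is 'I_m = {0, .., m - 1}, and R^m is
   'rV[R]_m. A function on U is a total function all of whose hypotheses and
   conclusions are restricted to arguments in U. *)

Definition partition_family (t m : nat) (P : 'I_t -> {set 'I_m}) : Prop :=
  [/\ forall i, P i != finset.set0,
      forall i j, i != j -> [disjoint P i & P j] &
      forall k, exists i, k \in P i].

Definition std_basis (R : realType) (m : nat) (i : 'I_m) : 'rV[R]_m :=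
  delta_mx 0 i.

Definition coord_cone (R : realType) (m : nat) (J : {set 'I_m}) :
    set 'rV[R]_m :=
  [set x | exists a : 'I_m -> R,
     (forall i, i \in J -> 0 <= a i) /\
     x = \sum_(i in J) a i *: std_basis R i]%classic.
Arguments coord_cone R {m} J.

Definition zero_one_points (R : realType) (m : nat) (U : set 'rV[R]_m) :
    set 'rV[R]_m :=
  [set a | U a /\ forall i, a 0 i = 0 \/ a 0 i = 1]%classic.

(* The reversed inequality of [convex_function] from mathcomp-analysis. *)
Definition concave_function (R : numFieldType) (E : lmodType R)
    (E' := convex_lmodType E) (D : set E') (f : E' -> R^o) : Prop :=
  forall t : {i01 R},
    {in D &, forall x y : E', f x <| t |> f y <= f (x <| t |> y)}.

Definition positively_homogeneous (R : numDomainType) (E : lmodType R)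
    (D : set E) (f : E -> R) : Prop :=
  forall (alpha : R) (v : E), 0 < alpha -> D v -> f (alpha *: v) = alpha * f v.

Definition restriction (R : realType) (m : nat) (Q : {set 'I_m})
    (x : 'rV[R]_m) : 'rV[R]_#|Q| :=
  \row_k x 0 (enum_val k).

(* With 0-based j, [decreasing_coord x j] is the (j+1)-st largest coordinate
   of x, counted with multiplicity. *)
Definition decreasing_coord (R : realType) (p : nat) (x : 'rV[R]_p)
    (j : 'I_p) : R :=
  nth 0 (sort >=%R [seq x 0 k | k : 'I_p]) j.

Definition sorted_sum (R : realType) (t m : nat) (P : 'I_t -> {set 'I_m})
    (alpha : forall i : 'I_t, 'I_#|P i| -> R) (a : 'rV[R]_m) : R :=
  \sum_(i < t) \sum_(j < #|P i|)
    alpha i j * decreasing_coord (restriction (P i) a) j.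

(* Main.v *)
(** A vector [a] of the cone whose least positive coordinate is [c] splits as
    [a = b + c *: 1_S], where [S] is the support of [a] and [b] has strictly
    smaller support; iterating writes [a] as a positive combination of 0/1
    points whose supports form a chain.  Convexity and homogeneity make [phi]
    subadditive along this decomposition.  In case (i) [f] is superadditive;
    in case (ii) it is additive along the chain, because [b] and [1_S] are
    images of [a] under nondecreasing maps of the line, so sorting [a] sorts
    them as well. *)

Require Import Defs.
From mathcomp Require Import all_boot all_order all_algebra.
From mathcomp Require Import interval_inference boolp classical_sets reals convex.
From mathcomp Require Import unstable lra.

Set Implicit Arguments.
Unset Strict Implicit.
Unset Printing Implicit Defensive.

Import Order.TTheory GRing.Theory Num.Theory.
Local Open Scope ring_scope.

Lemma coord_coneP (R : realType) (m : nat) (J : {set 'I_m}) (x : 'rV[R]_m) :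
  coord_cone R J x <->
  (forall i, 0 <= x 0 i) /\ (forall i, i \notin J -> x 0 i = 0).
Proof.
have coordE (a : 'I_m -> R) k :
    (\sum_(i in J) a i *: std_basis R i) 0 k = if k \in J then a k else 0.
  rewrite summxE; case: ifPn => kJ.
    rewrite (bigD1 k) //= big1 ?addr0 ?mxE ?eqxx ?mulr1 // => i /andP[_ ik].
    by rewrite !mxE eq_sym (negPf ik) andbF mulr0.
  rewrite big1 // => i iJ; rewrite !mxE [k == i](_ : _ = false) ?andbF ?mulr0 //.
  by apply/eqP => ki; rewrite ki iJ in kJ.
split=> [[a [a_ge0 ->]]|[x_ge0 xJ]].
  split=> i; rewrite coordE; first by case: ifP => // /a_ge0.
  by move/negPf=> ->.
exists (x 0); split=> [i _ //|]; apply/rowP => k; rewrite coordE.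
by case: ifPn => // /xJ.
Qed.

Lemma coord_coneD (R : realType) (m : nat) (J : {set 'I_m}) (x y : 'rV[R]_m) :
  coord_cone R J x -> coord_cone R J y -> coord_cone R J (x + y).
Proof.
move=> /coord_coneP[x0 xJ] /coord_coneP[y0 yJ]; apply/coord_coneP.
by split=> i => [|iJ]; rewrite mxE ?addr_ge0 // xJ // yJ // addr0.
Qed.

Lemma coord_coneZ (R : realType) (m : nat) (J : {set 'I_m}) (c : R)
    (x : 'rV[R]_m) :
  0 <= c -> coord_cone R J x -> coord_cone R J (c *: x).
Proof.
move=> c0 /coord_coneP[x0 xJ]; apply/coord_coneP.
by split=> i => [|iJ]; rewrite mxE ?mulr_ge0 // xJ // mulr0.
Qed.

Lemma coord_cone_map (R : realType) (m : nat) (J : {set 'I_m}) (g : R -> R)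
    (x : 'rV[R]_m) :
  g 0 = 0 -> (forall y, 0 <= g y) ->
  coord_cone R J x -> coord_cone R J (map_mx g x).
Proof.
move=> g0 g_ge0 /coord_coneP[_ xJ]; apply/coord_coneP.
by split=> i => [|iJ]; rewrite mxE // xJ.
Qed.

(** Convexity at the midpoint bounds [phi] at [2^-1 *: (x + y)] by the average of [phi x] and
    [phi y]; homogeneity then cancels the factor [2^-1]. *)
Lemma convex_subadditive (R : realType) (E : lmodType R) (U : set E)
    (phi : E -> R) :
  (forall x y, U x -> U y -> U (x + y)) ->
  (forall c x, 0 <= c -> U x -> U (c *: x)) ->
  convex_function U phi -> positively_homogeneous U phi ->
  forall x y, U x -> U y -> phi (x + y) <= phi x + phi y.
Proof.
move=> UD UZ phi_cvx phi_hom x y Ux Uy.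
have h0 : (0 : R) <= 2^-1 by lra.
have h1 : (2^-1 : R) <= 1 by lra.
have := phi_cvx (Itv01 h0 h1) x y (mem_set Ux) (mem_set Uy).
rewrite convRE /=.
have -> : conv (Itv01 h0 h1) (x : convex_lmodType E) y = 2^-1 *: (x + y).
  rewrite /conv /= scalerDr; congr (_ + _ *: _).
  by rewrite /onem /=; lra.
rewrite phi_hom ?invr_gt0 ?ltr0n //; last exact: UD.
by rewrite /onem /=; lra.
Qed.

Lemma concave_superadditive (R : realType) (E : lmodType R) (U : set E)
    (f : E -> R) :
  (forall x y, U x -> U y -> U (x + y)) ->
  (forall c x, 0 <= c -> U x -> U (c *: x)) ->
  concave_function U f -> positively_homogeneous U f ->
  forall x y, U x -> U y -> f x + f y <= f (x + y).
Proof.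
move=> UD UZ f_ccv f_hom x y Ux Uy.
suff : - f (x + y) <= - f x + - f y by lra.
apply: (@convex_subadditive _ _ U (fun z => - f z)) => //.
  move=> s u v uU vU; have := f_ccv s u v uU vU.
  by rewrite !convRE; lra.
by move=> c z c0 Uz; rewrite f_hom // mulrN.
Qed.

(** Both sides are decreasing rearrangements of the same multiset, and antisymmetry of the order
    makes such a list unique, even when [g] creates ties. *)
Lemma sort_ge_map (R : realType) (g : R -> R) (s : seq R) :
  {homo g : x y / x <= y} ->
  sort >=%R [seq g x | x <- s] = [seq g x | x <- sort >=%R s].
Proof.
move=> g_homo.
apply: (@sorted_eq _ (>=%R : rel R)).
- exact: rev_trans le_trans.
- by move=> x y /andP[xy yx]; apply: le_anti; apply/andP; split.
- by apply: sort_sorted => x y; rewrite le_total.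
- apply: (homo_sorted (e := >=%R)); first by move=> x y /g_homo.
  by apply: sort_sorted => x y; rewrite le_total.
- by rewrite perm_sort; apply: perm_map; rewrite perm_sym perm_sort.
Qed.

Lemma decreasing_coord_map (R : realType) (p : nat) (g : R -> R)
    (x : 'rV[R]_p) (j : 'I_p) :
  {homo g : y z / y <= z} ->
  decreasing_coord (map_mx g x) j = g (decreasing_coord x j).
Proof.
move=> g_homo; rewrite /decreasing_coord.
(* The index [j] is within range, so the default [0] is never read and [g] may move [0]. *)
rewrite -(nth_map _ 0) ?size_sort ?size_map -?enumT ?size_enum_ord //.
rewrite -sort_ge_map // -map_comp; congr (nth _ (sort _ _) _).
by apply: eq_map => k; rewrite mxE.
Qed.

Lemma decreasing_coord_val (R : realType) (p : nat) (x : 'rV[R]_p) (j : 'I_p) :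
  exists k, decreasing_coord x j = x 0 k.
Proof.
have : decreasing_coord x j \in sort >=%R [seq x 0 k | k : 'I_p].
  by rewrite mem_nth // size_sort size_map -?enumT size_enum_ord.
by rewrite mem_sort => /mapP[k _ ->]; exists k.
Qed.

(** The splitting is known only at the coordinates of [a]; it passes to the sorted ones because each
    of them is some coordinate of [a] and sorting commutes with [g] and [h]. *)
Lemma sorted_sum_map2 (R : realType) (t m : nat) (P : 'I_t -> {set 'I_m})
    (alpha : forall i : 'I_t, 'I_#|P i| -> R) (g h : R -> R) (c : R)
    (a : 'rV[R]_m) :
  {homo g : x y / x <= y} -> {homo h : x y / x <= y} ->
  (forall k, a 0 k = g (a 0 k) + c * h (a 0 k)) ->
  sorted_sum alpha a =
    sorted_sum alpha (map_mx g a) + c * sorted_sum alpha (map_mx h a).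
Proof.
move=> g_homo h_homo aE.
rewrite /sorted_sum mulr_sumr -big_split; apply: eq_bigr => i _.
rewrite mulr_sumr -big_split; apply: eq_bigr => j _.
have resM (u : R -> R) :
    restriction (P i) (map_mx u a) = map_mx u (restriction (P i) a).
  by apply/rowP => k; rewrite !mxE.
rewrite /= !resM !decreasing_coord_map //.
have [k ->] := decreasing_coord_val (restriction (P i) a) j.
by rewrite mxE mulrCA -mulrDr -aE.
Qed.

(** Truncating at [0] yields one nondecreasing map of the line that, for [c >= 0], fixes [0] while
    lowering the coordinates above [c]. *)
Definition peel (R : realType) (c x : R) : R := Num.max 0 (x - c).

Definition positive_indicator (R : realType) (x : R) : R := (0 < x)%R%:R.

Lemma peel_homo (R : realType) (c : R) : {homo peel c : x y / x <= y}.
Proof.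
by move=> x y xy; rewrite /peel ge_max !le_max lexx lerB ?orbT.
Qed.

Lemma positive_indicator_homo (R : realType) :
  {homo @positive_indicator R : x y / x <= y}.
Proof.
move=> x y xy; rewrite /positive_indicator ler_nat.
by case: (ltP 0 x) => // x0; rewrite (lt_le_trans x0 xy).
Qed.

(** Strictly between [0] and [c] the right side would equal [c], hence the gap assumed on [x]. *)
Lemma peelE (R : realType) (c x : R) :
  0 < c -> x = 0 \/ c <= x -> x = peel c x + c * positive_indicator x.
Proof.
rewrite /peel /positive_indicator => c0 [->|cx].
  by rewrite ltxx mulr0 addr0 max_l //; lra.
by rewrite (lt_le_trans c0 cx) mulr1 max_r; lra.
Qed.

Lemma peel_decomposition (R : realType) (m : nat) (c : R) (a : 'rV[R]_m) :
  0 < c -> (forall i, a 0 i = 0 \/ c <= a 0 i) ->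
  a = map_mx (peel c) a + c *: map_mx (@positive_indicator R) a.
Proof.
by move=> c_gt0 a_split; apply/rowP => i; rewrite !mxE; apply: peelE.
Qed.

Lemma coord_cone_peel (R : realType) (m : nat) (J : {set 'I_m}) (c : R)
    (a : 'rV[R]_m) :
  0 <= c -> coord_cone R J a -> coord_cone R J (map_mx (peel c) a).
Proof.
move=> c_ge0; apply: coord_cone_map => [|y]; rewrite /peel ?le_max ?lexx //.
by rewrite max_l //; lra.
Qed.

Lemma coord_cone_positive_indicator (R : realType) (m : nat) (J : {set 'I_m})
    (a : 'rV[R]_m) :
  coord_cone R J a -> coord_cone R J (map_mx (@positive_indicator R) a).
Proof.
by apply: coord_cone_map => [|y]; rewrite /positive_indicator ?ltxx ?ler0n.
Qed.

(** Superadditivity of [f] along a single peeling step is all that cases (i) and (ii) must supply;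
    the rest is induction on the size of the support. *)
Lemma zero_one_points_dominate (R : realType) (m : nat) (J : {set 'I_m})
    (phi f : 'rV[R]_m -> R) :
  let U := coord_cone R J in
  (forall x y, U x -> U y -> phi (x + y) <= phi x + phi y) ->
  positively_homogeneous U phi ->
  (forall a c, U a -> 0 < c -> (forall i, a 0 i = 0 \/ c <= a 0 i) ->
     f (map_mx (peel c) a) + c * f (map_mx (@positive_indicator R) a) <= f a) ->
  (forall a, zero_one_points U a -> phi a <= f a) ->
  forall a, U a -> phi a <= f a.
Proof.
move=> U phiD phi_hom f_peel f01 a.
have [n] := ubnP #|[set i | 0 < a 0 i]|.
elim: n a => // n IHn a supp_lt Ua.
have [a_ge0 _] := (coord_coneP _ _).1 Ua.
(* With empty support [a] is zero, itself a 0/1 point. *)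
have [[i0 ai0]|a_eq0] := pselect (exists i, 0 < a 0 i); last first.
  apply: f01; split=> // i; left; apply/le_anti; rewrite a_ge0 andbT leNgt.
  by apply/negP => ai; apply: a_eq0; exists i.
case: (@arg_minP _ _ _ i0 (fun i => 0 < a 0 i) (a 0) ai0) => k.
set c := a 0 k => c_gt0 c_min.
have a_split i : a 0 i = 0 \/ c <= a 0 i.
  have := a_ge0 i; rewrite le_eqVlt => /orP[/eqP <-|/c_min]; by [left|right].
set b := map_mx (peel c) a; set s := map_mx (@positive_indicator R) a.
have aE : a = b + c *: s by exact: peel_decomposition.
have Ub : U b by exact: coord_cone_peel (ltW c_gt0) Ua.
have Us : U s by exact: coord_cone_positive_indicator.
have le_b : phi b <= f b.
  apply: IHn => //; rewrite -ltnS; apply: leq_trans supp_lt; rewrite ltnS.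
  apply/proper_card/properP; split.
    apply/fintype.subsetP => i; rewrite !inE mxE /peel lt_max ltxx /= subr_gt0.
    exact: lt_trans.
  (* The minimizer [k] leaves the support, since its coordinate [c] is peeled to [0]. *)
  by exists k; rewrite !inE // mxE /peel -/c subrr maxxx ltxx.
have le_s : phi s <= f s.
  apply: f01; split=> // i; rewrite mxE /positive_indicator.
  by case: (0 < _); [right|left].
(* The chain is [phi a <= phi b + c * phi s <= f b + c * f s <= f a]. *)
apply: le_trans (f_peel a c Ua c_gt0 a_split).
rewrite {1}aE; apply: le_trans (phiD _ _ Ub (coord_coneZ (ltW c_gt0) Us)) _.
by rewrite phi_hom // lerD // ler_pM2l.
Qed.

Theorem theorem2p5 (R : realType) (t m : nat) (P : 'I_t -> {set 'I_m})
    (J : {set 'I_m}) (phi f : 'rV[R]_m -> R) :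
  let U := coord_cone R J in
  partition_family P ->
  convex_function U phi ->
  positively_homogeneous U phi ->
  (concave_function U f /\ positively_homogeneous U f) \/
  (exists alpha : forall i : 'I_t, 'I_#|P i| -> R,
     forall a, U a -> f a = sorted_sum alpha a) ->
  (forall a, U a -> phi a <= f a) <->
  (forall a, zero_one_points U a -> phi a <= f a).
Proof.
move=> U _ phi_cvx phi_hom f_cases.
split=> [le_U a [Ua _]|le_01]; first exact: le_U.
have UD := @coord_coneD R m J; have UZ := @coord_coneZ R m J.
apply: zero_one_points_dominate le_01 => //; first exact: convex_subadditive.
move=> a c Ua c_gt0 a_split.
have Ub := coord_cone_peel (ltW c_gt0) Ua.
have Us := coord_cone_positive_indicator Ua.
case: f_cases => [[f_ccv f_hom]|[alpha fE]].
  (* Homogeneity absorbs [c] into the argument, leaving plain superadditivity. *)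
  rewrite -f_hom // [a in leRHS](peel_decomposition c_gt0 a_split).
  by apply: (concave_superadditive (U := U)) => //; apply: UZ => //; exact: ltW.
(* The sorted formula applies at all three points because they lie in [U]; here equality holds. *)
rewrite !fE // -sorted_sum_map2 //.
- exact: peel_homo.
- exact: positive_indicator_homo.
- by move=> k; apply: peelE.
Qed.
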